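(* Let $k$ be an infinite field and let $S$ be a standard graded $k$-algebra of Krull dimension $d \geq 1$. Let $A = k[X_1, \dotsc, X_d] \subseteq S$ and $B = k[Y_1, \dotsc, Y_d] \subseteq S$ be graded Noether normalizations of $S$ (so $X_1,\dotsc,X_d$ and $Y_1,\dotsc,Y_d$ are homogeneous elements of degree $1$ of $S$). Then there is a proper $k$-subspace arrangement $M \subsetneq k^d$ such that for any $c = [c_1, \dotsc, c_d] \in k^d$, we have $c \in k^d \setminus M$ if and only if the inclusion $k[X_1, \dotsc, X_{d-1}, \sum_{j=1}^d c_j Y_j] \subseteq S$ is a graded Noether normalization.
   Context: All rings are commutative with identity. A $k$-algebra $S$ is a standard graded algebra if it is $\mathbb{N}$-graded and finitely generated as a $k$-algebra, $S_0 = k$, and $S = k[S_1]$. A ring homomorphism $g : R \to S$ of $\mathbb{N}$-graded algebras is graded if $g(R_n) \subseteq S_n$ for all $n \in \mathbb{N}$. If $R$ is a standard graded $k$-algebra of dimension $d$, a graded Noether normalization of $R$ is an injective graded ring homomorphism $A \hookrightarrow R$ such that $A$ is a polynomial ring in $d$ variables over $k$, standard graded so that all variables are homogeneous of degree $1$, and $R$ is finitely generated as an $A$-module. When one writes $k[X_1,\dotsc,X_d] \subseteq S$ for a graded Noether normalization, the $X_i$ are the (degree $1$, algebraically independent) images of the variables. A $k$-subspace arrangement in $k^d$ is a finite union of $k$-linear subspaces of $k^d$; it is proper if it is not all of $k^d$. *)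

(* Defs.v *)
From HB Require Import structures.
From mathcomp Require Import all_boot all_order all_algebra.
From mathcomp Require Import mpoly.

Set Implicit Arguments.
Unset Strict Implicit.
Unset Printing Implicit Defensive.

Import GRing.Theory.
Local Open Scope ring_scope.

(* Ideals and graded pieces are boolean predicates, as in ring_quotient.
   Under classical axioms every Prop-valued subset is of this form, so
   nothing is lost. *)

Definition infinite_field (k : fieldType) : Prop :=
  forall s : seq k, exists a, a \notin s.

(* idealr_closed already requires 1 \notin I. *)
Definition prime_ideal (R : comNzRingType) (I : {pred R}) : Prop :=
  idealr_closed I /\ prime_idealr_closed I.

(* P 0 < P 1 < ... < P n; the values of P beyond n are irrelevant. *)
Definition prime_chain (R : comNzRingType) (n : nat) (P : nat -> {pred R})
  : Prop :=
  (forall i, (i <= n)%N -> prime_ideal (P i)) /\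
  (forall i, (i < n)%N ->
     {subset P i <= P i.+1} /\ ~ {subset P i.+1 <= P i}).

Definition krull_dim (R : comNzRingType) (d : nat) : Prop :=
  (exists P : nat -> {pred R}, prime_chain d P) /\
  (forall n (P : nat -> {pred R}), prime_chain n P -> (n <= d)%N).

Section Evaluation.
Variables (k : fieldType) (S : comAlgType k) (n : nat).

Definition mpeval (x : 'I_n -> S) (p : {mpoly k[n]}) : S :=
  mmap (in_alg S) x p.

Variable x : 'I_n -> S.

Fact mpeval_is_zmod_morphism : zmod_morphism (mpeval x).
Proof. exact: mmapB. Qed.

Fact mpeval_is_monoid_morphism : monoid_morphism (mpeval x).
Proof.
by split; [exact: rmorph1 | exact: (rmorphM (mmap (in_alg S) x))].
Qed.

Fact mpeval_is_scalable : scalable (mpeval x).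
Proof. by move=> c p; rewrite /mpeval mmapZ /= mulr_algl. Qed.

HB.instance Definition _ :=
  GRing.isZmodMorphism.Build {mpoly k[n]} S (mpeval x) mpeval_is_zmod_morphism.
HB.instance Definition _ :=
  GRing.isMonoidMorphism.Build {mpoly k[n]} S (mpeval x)
    mpeval_is_monoid_morphism.
HB.instance Definition _ :=
  GRing.isScalable.Build k {mpoly k[n]} S *:%R (mpeval x) mpeval_is_scalable.

End Evaluation.

Section Graded.
Variables (k : fieldType) (S : comAlgType k).

(* y lies in the k-subalgebra k[A] generated by A. *)
Definition in_subalg (A : {pred S}) (y : S) : Prop :=
  exists n (x : 'I_n -> S), (forall i, x i \in A) /\
    exists p : {mpoly k[n]}, y = mpeval x p.

Definition fin_gen_algebra : Prop :=
  exists n (x : 'I_n -> S), forall y, exists p : {mpoly k[n]}, y = mpeval x p.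

(* S is the internal direct sum of the subspaces Sg i, and
   Sg i * Sg j is contained in Sg (i + j). *)
Definition is_grading (Sg : nat -> {pred S}) : Prop :=
  [/\ forall i, submod_closed (Sg i),
      forall i j x y, x \in Sg i -> y \in Sg j -> x * y \in Sg (i + j)%N,
      forall x, exists n (u : nat -> S),
        (forall i, u i \in Sg i) /\ x = \sum_(i < n) u i
    & forall n (u : nat -> S), (forall i, u i \in Sg i) ->
        \sum_(i < n) u i = 0 -> forall i, (i < n)%N -> u i = 0].

Definition standard_graded (Sg : nat -> {pred S}) : Prop :=
  [/\ is_grading Sg,
      forall x, x \in Sg 0%N <-> exists a : k, x = a%:A,
      fin_gen_algebra
    & forall y, in_subalg (Sg 1%N) y].

Definition module_finite (A : nzRingType) (phi : A -> S) : Prop :=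
  exists r (g : 'I_r -> S), forall y, exists a : 'I_r -> A,
    y = \sum_(i < r) phi (a i) * g i.

Definition graded_noether_normalization (Sg : nat -> {pred S}) (d : nat)
    (phi : {lrmorphism {mpoly k[d]} -> S}) : Prop :=
  [/\ krull_dim S d,
      injective phi,
      forall m (p : {mpoly k[d]}), p \is m.-homog -> phi p \in Sg m
    & module_finite phi].

(* The inclusion k[x_0, ..., x_(d-1)] <= S is a graded Noether normalization,
   the x_i being the images of the variables. *)
Definition is_gnn (Sg : nat -> {pred S}) (d : nat) (x : 'I_d -> S) : Prop :=
  graded_noether_normalization Sg (mpeval x).

Definition replace_last (d : nat) (x : 'I_d -> S) (y : S) : 'I_d -> S :=
  fun i => if (i.+1 < d)%N then x i else y.

End Graded.

(* A subspace arrangement in k^d is given by the finite list of its subspaces. *)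
Definition in_arrangement (k : fieldType) (d : nat)
    (M : seq {vspace 'rV[k]_d}) (c : 'rV[k]_d) : Prop :=
  exists2 V, V \in M & c \in V.

Definition proper_arrangement (k : fieldType) (d : nat)
    (M : seq {vspace 'rV[k]_d}) : Prop :=
  exists c, ~ in_arrangement M c.

(* Main.v *)
(* Let I be the ideal of S generated by X_1, ..., X_(d-1), and u = X_d. Since S
   is finite over k[X_1, ..., X_d], multiplication by u is bijective between the
   homogeneous pieces of S/I in large degree, so that each s of degree m acts on
   a stable piece W through s / u^m, and these operators commute. For a linear
   form z, S is finite over k[X_1, ..., X_(d-1), z] iff z acts invertibly on W.
   Commuting operators have a composition series of W on whose factors each
   combination of the Y_j acts by zero or invertibly; the combinations acting by
   zero on a given factor form a subspace, which is proper because a power of u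
   lies in the ideal of S generated by the Y_j, and an infinite field does not
   allow finitely many proper subspaces to cover k^d. That finiteness implies
   algebraic independence is a rank count over k[X_1, ..., X_(d-1)]. *)

Require Import Defs.
From HB Require Import structures.
From mathcomp Require Import all_boot all_order all_algebra.
From mathcomp Require Import mpoly.
From Stdlib Require Import FunctionalExtensionality Classical ClassicalEpsilon.

Set Implicit Arguments.
Unset Strict Implicit.
Unset Printing Implicit Defensive.

Import GRing.Theory.
Local Open Scope ring_scope.

(** * Linear algebra: unions of subspaces and commuting matrices *)

(** If a point [c] avoiding [s] lies in [V], take [v] outside [V]: no point of the line [v + a *: c]
    is in [V], and each member of [s] excludes at most one [a]. *)
Lemma vspace_union_avoid (k : fieldType) (vT : vectType k)
    (s : seq {vspace vT}) :
  infinite_field k -> (forall V, V \in s -> V != fullv) ->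
  exists v, forall V, V \in s -> v \notin V.
Proof.
move=> kinf; elim: s => [|V s IH] Hs; first by exists 0.
have [c Hc] := IH (fun W Ws => Hs W (mem_behead (s := V :: s) Ws)).
have [cV|cV] := boolP (c \in V); last first.
  by exists c => W; rewrite inE => /predU1P[->|/Hc].
have /subvPn [v _ vV] : ~~ ({:vT} <= V)%VS.
  by have := Hs V (mem_head _ _); rewrite eqEsubv subvf.
have [t Ht] : exists t : seq k, forall a W, W \in s -> v + a *: c \in W -> a \in t.
  elim: s Hc {IH Hs} => [|W s IH] Hc; first by exists [::].
  have [t Ht] := IH (fun W' Ws => Hc W' (mem_behead (s := W :: s) Ws)).
  have [[b bW]|nb] := classic (exists b, v + b *: c \in W).
    exists (b :: t) => a W'; rewrite !inE => /predU1P[->|/Ht H /H ->]; last first.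
      by rewrite orbT.
    move=> aW; have := rpredB aW bW; rewrite opprD addrACA subrr add0r -scalerBl.
    by rewrite rpredZeq (negPf (Hc W (mem_head _ _))) orbF subr_eq0 => ->.
  exists t => a W'; rewrite inE => /predU1P[->|/Ht]; last exact.
  by move=> aW; case: nb; exists a.
have [a at_] := kinf t.
exists (v + a *: c) => W; rewrite inE => /predU1P[->|Ws].
  by rewrite rpredDr ?rpredZ.
by apply: contra at_; apply: Ht.
Qed.

Section BlockReduction.
Variables (k : fieldType) (n r s : nat) (P : 'M[k]_(r + s, n)) (Q : 'M[k]_(n, r + s)).
Hypotheses (PQ : P *m Q = 1%:M) (QP : Q *m P = 1%:M).

Lemma unitmx_change_basis (A : 'M[k]_n) :
  (P *m A *m Q \in unitmx) = (A \in unitmx).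
Proof.
apply/idP/idP => uA.
  suff /mulmx1_unit[] : (Q *m invmx (P *m A *m Q) *m P) *m A = 1%:M by [].
  have := mulVmx uA; set B := invmx _ => BA.
  by rewrite -[LHS]mulmx1 -[in X in _ *m X]QP -[RHS]QP -[Q in RHS]mulmx1 -BA !mulmxA.
suff /mulmx1_unit[] : (P *m A *m Q) *m (P *m invmx A *m Q) = 1%:M by [].
rewrite !mulmxA -(mulmxA _ Q P) QP mulmx1 -(mulmxA _ A (invmx A)) mulmxV //.
by rewrite mulmx1.
Qed.

Lemma mulmx_change_basis (A B : 'M[k]_n) :
  (P *m A *m Q) *m (P *m B *m Q) = P *m (A *m B) *m Q.
Proof. by rewrite !mulmxA -(mulmxA _ Q P) QP mulmx1. Qed.

End BlockReduction.

(** The rows of [P] are a basis of [U] followed by one of a complement. They depend on [U] only, so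
    all operators stabilizing [U] become block triangular at once. *)
Lemma stablemx_block (k : fieldType) (n : nat) (U : 'M[k]_n) :
  exists s (P : 'M[k]_(\rank U + s, n)) (Q : 'M[k]_(n, \rank U + s)),
  [/\ (\rank U + s)%N = n, P *m Q = 1%:M, Q *m P = 1%:M
    & forall L, stablemx U L -> ursubmx (P *m L *m Q) = 0].
Proof.
pose P := col_mx (row_base U) (row_base U^C%MS).
have Pr : \rank P = n.
  rewrite -addsmxE (adds_eqmx (eq_row_base U) (eq_row_base _)).
  by have /eqP := addsmx_compl_full U.
have rs : (\rank U + \rank U^C)%N = n by rewrite mxrank_compl subnKC ?rank_leq_row.
have Pfree : row_free P by rewrite /row_free Pr rs.
have Pfull : row_full P by rewrite /row_full Pr.
exists (\rank U^C), P, (pinvmx P); split=> //.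
- exact: mulmxVp.
- exact: mulVpmx.
move=> L UL.
have /submxP[A EA] : (row_base U *m L <= row_base U)%MS.
  apply: submx_trans (_ : (U <= row_base U)%MS); last by rewrite eq_row_base.
  by rewrite (eqmxMr _ (eq_row_base U)).
(* The upper half of [P *m pinvmx P = 1%:M] says that [row_base U] has coordinates [(1 0)], so
   [A *m row_base U] has zero right block. *)
have := mulmxVp Pfree; rewrite {1}/P mul_col_mx scalar_mx_block block_mxEv.
move=> /eq_col_mx[E _].
by rewrite /P !mul_col_mx EA -mulmxA E mul_mx_row mulmx1 mulmx0 /ursubmx col_mxKu row_mxKr.
Qed.

(** Strong induction on [e]. A nonzero singular combination has a proper nonzero kernel stable under
    every [L j] and [M j], and invertibility is then tested on two smaller diagonal blocks. The
    [M j] carry to each block the relation that keeps the [L j] from all vanishing there. *)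
Lemma commuting_sum_nonunit (k : fieldType) (d e : nat) (L M : 'I_d -> 'M[k]_e) :
  (forall i j, L i *m L j = L j *m L i) ->
  (forall i j, L i *m M j = M j *m L i) ->
  \sum_j L j *m M j = 1%:M ->
  exists s : seq {vspace 'rV[k]_d}, (forall V, V \in s -> V != fullv) /\
    forall c : 'rV[k]_d,
      (\sum_j c 0 j *: L j \notin unitmx) = has (fun V : {vspace 'rV[k]_d} => c \in V) s.
Proof.
elim/ltn_ind: e L M => e IH L M LL LM LM1.
pose F (c : 'rV[k]_d) := \sum_j c 0 j *: L j.
have [[c [Fc0 Fcu]]|simple] := classic (exists c, F c != 0 /\ F c \notin unitmx).
  have comm A : (forall i, L i *m A = A *m L i) -> stablemx (kermx (F c)) A.
    move=> LA; have EA : F c *m A = A *m F c.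
      rewrite mulmx_suml mulmx_sumr; apply: eq_bigr => j _.
      by rewrite -scalemxAl LA scalemxAr.
    by apply/sub_kermxP; rewrite -mulmxA -EA mulmxA mulmx_ker mul0mx.
  have [s [P [Q [rs PQ QP Hblk]]]] := stablemx_block (kermx (F c)).
  set r := \rank _ in s P Q rs PQ QP Hblk *.
  have r0 : (0 < r)%N.
    rewrite /r lt0n mxrank_eq0; apply: contra Fcu.
    by rewrite kermx_eq0 row_free_unit.
  have re : (r < e)%N.
    rewrite /r mxrank_ker -subSn ?rank_leq_row // leq_subLR addnC -addn1 leq_add2l.
    by rewrite lt0n mxrank_eq0.
  have se : (s < e)%N by rewrite -rs -[X in (X < _)%N]add0n ltn_add2r.
  pose T A := P *m A *m Q.
  have TE A : stablemx (kermx (F c)) A ->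
      T A = block_mx (ulsubmx (T A)) 0 (dlsubmx (T A)) (drsubmx (T A)).
    by move=> /Hblk E; rewrite -[LHS]submxK E.
  (* Diagonal blocks of block triangular matrices multiply separately, so the commutations and the
     sum relation pass to both blocks. *)
  have TM A B : stablemx (kermx (F c)) A -> stablemx (kermx (F c)) B ->
      ulsubmx (T (A *m B)) = ulsubmx (T A) *m ulsubmx (T B) /\
      drsubmx (T (A *m B)) = drsubmx (T A) *m drsubmx (T B).
    move=> sA sB; rewrite /T -(mulmx_change_basis QP) -!/(T _) (TE A) // (TE B) //.
    by rewrite mulmx_block !(mul0mx, mulmx0, add0r, addr0) !block_mxKul !block_mxKdr.
  have sL j : stablemx (kermx (F c)) (L j) by apply: comm => i; apply: LL.
  have sM j : stablemx (kermx (F c)) (M j) by apply: comm => i; apply: LM.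
  have T1 : T 1%:M = 1%:M by rewrite /T mulmx1 PQ.
  have Tsum G : T (\sum_(j < d) G j) = \sum_j T (G j).
    by rewrite /T mulmx_sumr mulmx_suml.
  have subsum (A : 'I_d -> 'M[k]_(r + s)) :
      ulsubmx (\sum_j A j) = \sum_j ulsubmx (A j) /\
      drsubmx (\sum_j A j) = \sum_j drsubmx (A j).
    by split; apply/matrixP => x y; rewrite !mxE !summxE; apply: eq_bigr => j _; rewrite !mxE.
  have subZ a (A : 'M[k]_(r + s)) : ulsubmx (a *: A) = a *: ulsubmx A /\
      drsubmx (a *: A) = a *: drsubmx A.
    by split; apply/matrixP => x y; rewrite !mxE.
  have [|||s1 [s1f Hs1]] := IH r re (fun j => ulsubmx (T (L j))) (fun j => ulsubmx (T (M j))).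
  - by move=> i j; rewrite -!(TM _ _ _ _).1 // LL.
  - by move=> i j; rewrite -!(TM _ _ _ _).1 // LM.
  - transitivity (ulsubmx (T (\sum_j L j *m M j))).
      rewrite Tsum (subsum _).1; apply: eq_bigr => j _.
      by rewrite (TM _ _ _ _).1.
    by rewrite LM1 T1 scalar_mx_block block_mxKul.
  have [|||s2 [s2f Hs2]] := IH s se (fun j => drsubmx (T (L j))) (fun j => drsubmx (T (M j))).
  - by move=> i j; rewrite -!(TM _ _ _ _).2 // LL.
  - by move=> i j; rewrite -!(TM _ _ _ _).2 // LM.
  - transitivity (drsubmx (T (\sum_j L j *m M j))).
      rewrite Tsum (subsum _).2; apply: eq_bigr => j _.
      by rewrite (TM _ _ _ _).2.
    by rewrite LM1 T1 scalar_mx_block block_mxKdr.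
  exists (s1 ++ s2); split=> [V|b].
    by rewrite mem_cat => /orP[/s1f|/s2f].
  rewrite has_cat -Hs1 -Hs2 -negb_and; congr (~~ _).
  have sb : stablemx (kermx (F c)) (F b).
    apply: comm => i; rewrite mulmx_suml mulmx_sumr; apply: eq_bigr => j _.
    by rewrite -scalemxAl LL scalemxAr.
  rewrite -(unitmx_change_basis PQ QP) -/(T (F b)) TE // unitmxE det_lblock unitrM.
  have TZ a A : T (a *: A) = a *: T A by rewrite /T -scalemxAr -scalemxAl.
  rewrite -!unitmxE /F Tsum (subsum _).1 (subsum _).2.
  rewrite (eq_bigr (fun j => b 0 j *: ulsubmx (T (L j)))) => [|j _]; last first.
    by rewrite TZ (subZ _ _).1.
  rewrite [in X in _ && X](eq_bigr (fun j => b 0 j *: drsubmx (T (L j)))) => [//|j _].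
  by rewrite TZ (subZ _ _).2.
(* Now every combination is zero or invertible. Size 0 is separate: the empty matrix is invertible,
   so no subspace is listed. *)
case: e => [|e] in L M LL LM LM1 F simple IH *.
  exists [::]; split=> // c /=; apply/negbTE; rewrite negbK.
  by rewrite unitmxE det_mx00 unitr1.
have Flin : linear F.
  move=> a u v; rewrite /F scaler_sumr -big_split /=; apply: eq_bigr => j _.
  by rewrite !mxE scalerDl scalerA.
pose Fl : {linear 'rV[k]_d -> 'M[k]_e.+1} :=
  HB.pack F (GRing.isLinear.Build _ _ _ _ F Flin).
have kerE c : (c \in lker (linfun Fl)) = (F c == 0).
  by rewrite memv_ker lfunE.
exists [:: lker (linfun Fl)]; split=> [V|c]; last first.
  rewrite /= orbF kerE; apply/idP/eqP => [nu|].
    by apply/eqP; apply: contraT => nz; case: simple; exists c.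
  by rewrite -/(F c) => ->; rewrite unitmxE det0 unitr0.
(* Were the kernel everything, each [L j] would vanish, against the sum being the identity. *)
rewrite inE => /eqP->; apply/eqP => kerf.
have L0 j : L j = 0.
  have : F (delta_mx 0 j) == 0 by rewrite -kerE kerf memvf.
  rewrite /F (bigD1 j) //= big1 => [|i ij]; last first.
    by rewrite mxE eqxx (negPf ij) scale0r.
  by rewrite mxE !eqxx scale1r addr0 => /eqP.
move: LM1; rewrite big1 => [/esym/eqP|j _]; last by rewrite L0 mul0mx.
by rewrite (negPf (matrix_nonzero1 _ _)).
Qed.

(** * Graded algebras: homogeneous components and finiteness over linear forms *)

Section Grading.
Variables (k : fieldType) (S : comAlgType k) (Sg : nat -> {pred S}).
Hypothesis gr : is_grading Sg.

Lemma grading_rpred0 n : 0 \in Sg n.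
Proof. by have [/(_ n)[]] := gr. Qed.

Lemma grading_rpredDZ n a x y : x \in Sg n -> y \in Sg n -> a *: x + y \in Sg n.
Proof. by have [/(_ n)[_ H] _ _ _] := gr; apply: H. Qed.

Lemma grading_rpredZ n a x : x \in Sg n -> a *: x \in Sg n.
Proof. by move=> xn; rewrite -[_ *: _]addr0 grading_rpredDZ ?grading_rpred0. Qed.

Lemma grading_rpred_sum n (I : finType) (F : I -> S) :
  (forall i, F i \in Sg n) -> \sum_i F i \in Sg n.
Proof.
move=> Fn; apply: (big_ind (fun x => x \in Sg n)) => //.
  exact: grading_rpred0.
by move=> x y xn yn; rewrite -[x]scale1r grading_rpredDZ.
Qed.

Lemma grading_rpredM i j x y : x \in Sg i -> y \in Sg j -> x * y \in Sg (i + j)%N.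
Proof. by have [_ H _ _] := gr; apply: H. Qed.

Let components (x : S) (u : nat -> S) :=
  (forall i, u i \in Sg i) /\
  exists N, forall N', (N <= N')%N -> x = \sum_(i < N') u i.

Let componentsP x : exists u, components x u.
Proof.
have [_ _ /(_ x)[n [u [un ->]]] _] := gr.
exists (fun i => if (i < n)%N then u i else 0); split=> [i|].
  by case: ifP => _; rewrite ?un ?grading_rpred0.
exists n => N' nN'; rewrite (big_ord_widen_cond _ xpredT u nN') big_mkcond.
by apply: eq_bigr => i _.
Qed.

Let components_uniq x u v : components x u -> components x v -> u =1 v.
Proof.
move=> [un [N HN]] [vn [M HM]] i; have [_ _ _ gr4] := gr.
apply/eqP; rewrite -subr_eq0; apply/eqP.
apply: (gr4 (maxn i.+1 (maxn N M)) (fun i => u i - v i)); last first.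
- exact: leq_maxl.
- by rewrite sumrB -HN -?HM ?subrr // !leq_max leqnn ?orbT.
- by move=> j; rewrite addrC -scaleN1r grading_rpredDZ.
Qed.

(** Components are given only by existence, so they are chosen; uniqueness of the decomposition
    yields linearity and the product rule. *)
Lemma grading_projection : exists pi : nat -> S -> S,
  [/\ forall n x, pi n x \in Sg n,
      forall n a x y, pi n (a *: x + y) = a *: pi n x + pi n y,
      forall n x, x \in Sg n -> pi n x = x,
      forall a n x y, x \in Sg a ->
        pi n (x * y) = if (a <= n)%N then x * pi (n - a)%N y else 0
    & forall x, exists N, (forall n, (N <= n)%N -> pi n x = 0) /\
        x = \sum_(n < N) pi n x].
Proof.
pose c x := constructive_indefinite_description _ (componentsP x).
pose pi n x := sval (c x) n; exists pi.
have piP x : components x (pi^~ x) by exact: (svalP (c x)).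
have piE x u : components x u -> forall n, pi n x = u n.
  by move=> xu; apply: components_uniq (piP x) xu.
split.
- by move=> n x; have [] := piP x.
- move=> n a x y; apply: (piE _ (fun n => a *: pi n x + pi n y)).
  have [xn [N HN]] := piP x; have [yn [M HM]] := piP y.
  split=> [i|]; first exact: grading_rpredDZ.
  exists (maxn N M) => N'; rewrite geq_max => /andP[/HN Ex /HM Ey].
  by rewrite big_split /= -scaler_sumr -Ex -Ey.
- move=> n x xn; rewrite (piE _ (fun m => if m == n then x else 0)) ?eqxx //.
  split=> [i|]; first by case: eqP => [->|]; rewrite ?grading_rpred0.
  exists n.+1 => N' nN'; rewrite (bigD1 (Ordinal nN')) //= eqxx big1 ?addr0 // => i.
  by rewrite -val_eqE /= => /negPf->.
- move=> a n x y xa; have [yn [N HN]] := piP y.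
  rewrite (piE _ (fun m => if (a <= m)%N then x * pi (m - a)%N y else 0)) //.
  split=> [i|].
    by case: leqP => [ai|_]; rewrite ?grading_rpred0 // -{2}(subnKC ai) grading_rpredM.
  exists (a + N)%N => N' aN.
  rewrite -(subnKC (leq_trans (leq_addr _ _) aN)) big_split_ord /= big1 => [|i _].
    rewrite add0r (eq_bigr (fun i : 'I__ => x * pi i y)) => [|i _]; last first.
      by rewrite leq_addr addKn.
    by rewrite -mulr_sumr -HN // leq_subRL // (leq_trans (leq_addr _ _) aN).
  by rewrite leqNgt ltn_ord.
- move=> x; have [xn [N HN]] := piP x; exists N; split; last exact: HN.
  (* Beyond [N] the sums of lengths [n] and [n.+1] both equal [x], so the extra term is zero. *)
  move=> n Nn; have := HN _ (leqW Nn); rewrite big_ord_recr /= -HN //.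
  by rewrite -{1}[x]addr0 => /addrI.
Qed.

Definition kspan (T : finType) (w : T -> S) (y : S) :=
  exists a : T -> k, y = \sum_t a t *: w t.

Definition homog_fin_dim := forall n, exists (T : finType) (w : T -> S),
  (forall t, w t \in Sg n) /\ forall y, y \in Sg n -> kspan w y.

Lemma kspanDZ (T : finType) (w : T -> S) c x y :
  kspan w x -> kspan w y -> kspan w (c *: x + y).
Proof.
move=> [a ->] [b ->]; exists (fun t => c * a t + b t).
rewrite scaler_sumr -big_split /=; apply: eq_bigr => t _.
by rewrite scalerDl scalerA.
Qed.

Lemma kspan0 (T : finType) (w : T -> S) : kspan w 0.
Proof. by exists (fun _ => 0); rewrite big1 // => t _; rewrite scale0r. Qed.

Lemma kspan_mem (T : finType) (w : T -> S) t : kspan w (w t).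
Proof.
exists (fun t' => (t' == t)%:R); rewrite (bigD1 t) //= eqxx scale1r big1 ?addr0 //.
by move=> i /negPf->; rewrite scale0r.
Qed.

Section Evaluation.
Variables (d : nat) (x : 'I_d -> S).
Hypotheses (gr1 : 1 \in Sg 0) (x1 : forall i, x i \in Sg 1).

Lemma mpevalX_homog m : mpeval x 'X_[m] \in Sg (mdeg m).
Proof.
rewrite /mpeval mmapX /mmap1 mdegE.
apply: (big_rec2 (fun (y : S) n => y \in Sg n)) => // i n y _ yn.
apply: grading_rpredM => //; elim: (m i) => [|j IH]; first by rewrite expr0.
by rewrite exprS -add1n grading_rpredM.
Qed.

Lemma mpevalDZ c p q : mpeval x (c *: p + q) = c *: mpeval x p + mpeval x q.
Proof. by rewrite linearP. Qed.

Lemma mpeval_homog n p : p \is n.-homog -> mpeval x p \in Sg n.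
Proof.
move=> /dhomogP pn; rewrite [p]mpolyE big_seq.
apply: (big_ind (fun p => mpeval x p \in Sg n)) => [|q1 q2 H1 H2|m /pn <-].
- by rewrite raddf0 grading_rpred0.
- by rewrite -[q1]scale1r mpevalDZ grading_rpredDZ.
- by rewrite -[_ *: _]addr0 mpevalDZ raddf0 grading_rpredDZ ?grading_rpred0 ?mpevalX_homog.
Qed.

Definition lin_comb n (y : S) :=
  exists s : 'I_d -> S, (forall i, s i \in Sg n) /\ y = \sum_i x i * s i.

(** A graded Nakayama criterion: when the pieces are finite dimensional, it is equivalent to
    finiteness over the subalgebra generated by the [x i]. *)
Definition eventually_generating :=
  exists N, forall n y, (N <= n)%N -> y \in Sg n.+1 -> lin_comb n y.

Lemma lin_combDZ n c y z : lin_comb n y -> lin_comb n z -> lin_comb n (c *: y + z).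
Proof.
move=> [s [sn ->]] [t [tn ->]]; exists (fun i => c *: s i + t i).
split=> [i|]; first exact: grading_rpredDZ.
rewrite scaler_sumr -big_split; apply: eq_bigr => i _.
by rewrite mulrDr scalerAr.
Qed.

Lemma lin_comb0 n : lin_comb n 0.
Proof.
exists (fun _ => 0); split=> [_|]; first exact: grading_rpred0.
by rewrite big1 // => i _; rewrite mulr0.
Qed.

Lemma lin_comb_mul n i y : y \in Sg n -> lin_comb n (x i * y).
Proof.
move=> yn; exists (fun j => if j == i then y else 0); split=> [j|].
  by case: eqP => _; rewrite ?grading_rpred0.
rewrite (bigD1 i) //= eqxx big1 ?addr0 // => j /negPf->.
by rewrite mulr0.
Qed.

(* Any property of homogeneous elements of degree n stable under linear
   combinations only needs to be checked on x^m pi_(n - |m|) (g i). *)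
Lemma module_finite_ind r (g : 'I_r -> S) (pi : nat -> S -> S) n (P : S -> Prop) :
  (forall n a x y, pi n (a *: x + y) = a *: pi n x + pi n y) ->
  (forall n x, x \in Sg n -> pi n x = x) ->
  (forall a n x y, x \in Sg a ->
     pi n (x * y) = if (a <= n)%N then x * pi (n - a)%N y else 0) ->
  (forall y, exists a : 'I_r -> {mpoly k[d]}, y = \sum_i mpeval x (a i) * g i) ->
  P 0 -> (forall c y z, P y -> P z -> P (c *: y + z)) ->
  (forall m i, (mdeg m <= n)%N -> P (mpeval x 'X_[m] * pi (n - mdeg m)%N (g i))) ->
  forall y, y \in Sg n -> P y.
Proof.
move=> piDZ pi_id piM Hg P0 PDZ PX y yn; have [a Ey] := Hg y.
have pi0 : pi n 0 = 0 by apply: pi_id; apply: grading_rpred0.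
rewrite -(pi_id _ _ yn) Ey; elim/big_ind: _; first by rewrite pi0.
  by move=> u v Hu Hv; rewrite -[u]scale1r piDZ; apply: PDZ.
move=> i _; elim/mpolyind: (a i) => [|c m p _ _ Hp].
  by rewrite raddf0 mul0r pi0.
rewrite mpevalDZ mulrDl -scalerAl piDZ; apply: PDZ => //.
by rewrite (piM (mdeg m)) ?mpevalX_homog //; case: leqP => [/PX|].
Qed.

(** Past the degrees where the generators have components, a monomial times a component of [g i]
    vanishes unless the monomial is nonconstant, and then a variable factors out. *)
Lemma module_finite_eventually_generating :
  module_finite (mpeval x) -> eventually_generating.
Proof.
move=> [r [g Hg]]; have [pi [pi_in piDZ pi_id piM pi_supp]] := grading_projection.
have [N HN] := fin_all_exists (fun i => pi_supp (g i)).
exists (\max_i N i)%N => n y Nn.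
apply: (module_finite_ind piDZ pi_id piM Hg); first exact: lin_comb0.
  by move=> c u v; apply: lin_combDZ.
move=> m i mn; have [m0|m_neq0] := eqVneq m 0%MM.
  rewrite m0 mdeg0 subn0 (HN i).1 ?mulr0; first exact: lin_comb0.
  by rewrite leqW // (leq_trans _ Nn) // leq_bigmax.
have [j mj] : exists j, m j != 0%N.
  apply/existsP; rewrite -negb_forall; apply: contra m_neq0 => /forallP m0.
  by apply/eqP/mnmP => j; rewrite mnm0E; apply/eqP.
have Em : m = (U_(j) + (m - U_(j)))%MM by rewrite addmC submK // lep1mP.
have dm : mdeg m = (mdeg (m - U_(j))).+1 by rewrite {1}Em mdegD mdeg1.
rewrite {1}Em mpolyXD rmorphM /= -mulrA {1}/mpeval mmapX mmap1U.
apply: lin_comb_mul; rewrite dm subSS; rewrite dm ltnS in mn.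
by rewrite -{2}(subnKC mn) grading_rpredM ?mpevalX_homog.
Qed.

Lemma module_finite_homog_fin_dim : module_finite (mpeval x) -> homog_fin_dim.
Proof.
move=> [r [g Hg]] n; have [pi [pi_in piDZ pi_id piM pi_supp]] := grading_projection.
pose w (t : 'X_{1..d < n.+1} * 'I_r) :=
  mpeval x 'X_[t.1] * pi (n - mdeg t.1)%N (g t.2).
exists _, w; split=> [[m i]|].
  have mn : (mdeg m <= n)%N by rewrite -ltnS bmdeg.
  by rewrite -{2}(subnKC mn) grading_rpredM ?mpevalX_homog.
apply: (module_finite_ind piDZ pi_id piM Hg); first exact: kspan0.
  by move=> c u v; apply: kspanDZ.
by move=> m i mn; exact: (kspan_mem w (BMultinom (mn : (mdeg m < n.+1)%N), i)).
Qed.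

End Evaluation.

(** Spanning families of the pieces of degree at most [N] generate the module; higher forms are
    reached by induction on the degree. *)
Lemma eventually_generating_module_finite d (x : 'I_d -> S) :
  homog_fin_dim -> eventually_generating x -> module_finite (mpeval x).
Proof.
move=> fd [N HN].
have [T [w Hw]] : exists (T : finType) (w : T -> S),
    forall n y, (n <= N)%N -> y \in Sg n -> kspan w y.
  elim: N {HN} => [|N [T [w Hw]]].
    by have [T [w [_ Hw]]] := fd 0%N; exists T, w => n y; rewrite leqn0 => /eqP->; apply: Hw.
  have [T' [w' [_ Hw']]] := fd N.+1.
  exists (T + T')%type, (fun t => match t with inl t => w t | inr t => w' t end).
  move=> n y; rewrite leq_eqVlt ltnS => /predU1P[->|nN] yn.
    have [a ->] := Hw' y yn.
    exists (fun t => match t with inl t => 0 | inr t => a t end).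
    by rewrite big_sumType /= [X in _ = X + _]big1 ?add0r // => t _; rewrite scale0r.
  have [a ->] := Hw n y nN yn.
  exists (fun t => match t with inl t => a t | inr t => 0 end).
  by rewrite big_sumType /= [X in _ = _ + X]big1 ?addr0 // => t _; rewrite scale0r.
pose span y := exists a : T -> {mpoly k[d]}, y = \sum_t mpeval x (a t) * w t.
have span_sum (I : finType) (F : I -> S) : (forall i, span (F i)) -> span (\sum_i F i).
  move=> /fin_all_exists[a Ha]; exists (fun t => \sum_i a i t).
  rewrite (eq_bigr _ (fun i _ => Ha i)) exchange_big; apply: eq_bigr => t _.
  by rewrite raddf_sum mulr_suml.
have span_hom n y : y \in Sg n -> span y.
  elim: n y => [|n IH] y yn; last have [nN|Nn] := leqP n.+1 N.
  - have [a ->] := Hw _ _ (leq0n N) yn; exists (fun t => (a t)%:MP).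
    by apply: eq_bigr => t _; rewrite /mpeval mmapC /= mulr_algl.
  - have [a ->] := Hw _ _ nN yn; exists (fun t => (a t)%:MP).
    by apply: eq_bigr => t _; rewrite /mpeval mmapC /= mulr_algl.
  have [s [sn ->]] := HN n y Nn yn; apply: span_sum => i.
  have [a ->] := IH _ (sn i); exists (fun t => 'X_i * a t).
  rewrite mulr_sumr; apply: eq_bigr => t _.
  by rewrite rmorphM /= {2}/mpeval mmapX mmap1U mulrA.
exists #|T|, (fun i => w (enum_val i)) => y.
have [a Ha] : span y.
  have [pi [pi_in _ _ _ /(_ y)[M [_ ->]]]] := grading_projection.
  by apply: span_sum => i; apply: span_hom (pi_in _ _).
exists (fun i => a (enum_val i)); rewrite Ha.
by rewrite (reindex_onto enum_val enum_rank) /= => [|t _]; rewrite ?enum_rankK //;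
  apply: eq_bigl => i; rewrite enum_valK eqxx.
Qed.

End Grading.

(** * Splitting off the last variable, and algebraic independence *)

Section LastVariable.
Variables (k : fieldType) (n : nat).
Local Notation widen := (widen_ord (leqnSn n)).

Lemma muniX m : muni ('X_[m] : {mpoly k[n.+1]}) =
  'X_[[multinom m (widen i) | i < n]] *: 'X^(m ord_max).
Proof. by rewrite muniE msuppX big_seq1 mcoeffX eqxx scale1r. Qed.

Lemma coef_muni (p : {mpoly k[n.+1]}) (m : 'X_{1..n.+1}) :
  (muni p)`_(m ord_max)@_[multinom m (widen i) | i < n] = p@_m.
Proof.
elim/mpolyind: p => [|c m' p _ _ IH]; first by rewrite muni0 coef0 !mcoeff0.
rewrite muniD muniZ muniX coefD mcoeffD IH mcoeffD; congr (_ + _).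
rewrite !coefZ coefXn mcoeffCM mcoeffZ mcoeffX; congr (_ * _).
have [->|neq] := eqVneq m' m; first by rewrite eqxx mulr1 mcoeffX eqxx.
have [Em|] := eqVneq (m ord_max) (m' ord_max); last by rewrite mulr0 mcoeff0.
rewrite mulr1 mcoeffX; case: eqP => // /mnmP Ew; case/eqP: neq.
apply/mnmP => i; case: (unliftP ord_max i) => [j ->|->//].
have := Ew j; rewrite !mnmE (_ : widen j = lift ord_max j) //.
by apply/val_inj; rewrite /= /bump leqNgt ltn_ord.
Qed.

Lemma muni_inj : injective (@muni n k).
Proof. by move=> p q E; apply/mpolyP => m; rewrite -!coef_muni E. Qed.

Lemma muni_mwiden (q : {mpoly k[n]}) : muni (mwiden q) = q%:P.
Proof.
elim/mpolyind: q => [|c m q _ _ IH]; first by rewrite mwiden0 muni0.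
rewrite mwidenD muniD IH mwidenZ mwidenX muniZ muniX mnmwiden_ordmax expr0.
rewrite polyCD -mul_mpolyC polyCM; congr (_ + _).
rewrite alg_polyC -mul_polyC; congr (_ * ('X_[_])%:P).
by apply/mnmP => i; rewrite mnmE mnmwiden_widen.
Qed.

Lemma mmultiK : cancel (@mmulti n k) (@muni n k).
Proof.
move=> P; rewrite -[RHS]coefK poly_def /mmulti raddf_sum; apply: eq_bigr => i _.
rewrite /= muniM muni_mwiden mul_polyC mpolyXn muniX mulmnE mnm1E eqxx mul1n.
rewrite (_ : [multinom _ | _ < n] = 0%MM) ?mpolyX0 ?scale1r //.
by apply/mnmP => j; rewrite mnmE mulmnE mnm1E mnm0E -val_eqE /= gtn_eqF.
Qed.

Lemma mpeval_muni (S : comAlgType k) (x : 'I_n.+1 -> S) p :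
  mpeval x p = (map_poly (mpeval (x \o widen)) (muni p)).[x ord_max].
Proof.
elim/mpolyind: p => [|c m p _ _ IH]; first by rewrite !raddf0 horner0.
rewrite linearP /= IH muniD muniZ muniX rmorphD /= hornerD; congr (_ + _).
rewrite !map_polyZ /= map_polyXn !hornerZ hornerXn /mpeval mmapC !mmapX /=.
by rewrite mulr_algl /mmap1 big_ord_recr /=; under [in RHS]eq_bigr do rewrite mnmE.
Qed.

(** This form of algebraic independence isolates the last value, the only one that will be
    exchanged. *)
Lemma mpeval_injP (S : comAlgType k) (x : 'I_n.+1 -> S) :
  injective (mpeval x) <->
  forall P, (map_poly (mpeval (x \o widen)) P).[x ord_max] = 0 -> P = 0.
Proof.
split=> [inj P P0|H p q E].
  have E : mpeval x (mmulti P) = mpeval x 0 by rewrite mpeval_muni mmultiK P0 raddf0.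
  by rewrite -[P]mmultiK (inj _ _ E) muni0.
apply/eqP; rewrite -subr_eq0 -(inj_eq muni_inj) muni0; apply/eqP/H.
by rewrite -mpeval_muni raddfB /= E subrr.
Qed.

End LastVariable.

(* Over an algebraic element z, S would be spanned, up to multiplication by a
   power of the leading coefficient of the relation F, by fewer than
   size F * r elements over R, which leaves no room for all powers of u. *)
Lemma finite_over_transcendental (R : idomainType) (S : comNzRingType)
    (f : {rmorphism R -> S}) (u z : S) r (g : 'I_r -> S) :
  (forall P : {poly R}, (map_poly f P).[u] = 0 -> P = 0) ->
  (forall y, exists a : 'I_r -> {poly R}, y = \sum_i (map_poly f (a i)).[z] * g i) ->
  forall P : {poly R}, (map_poly f P).[z] = 0 -> P = 0.
Proof.
move=> u_tr Hg F F0; apply/eqP; apply: contraT => nzF.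
pose D := size F; pose l := lead_coef F.
have nzl : l != 0 by rewrite lead_coef_eq0.
(* Remainders modulo [F] provide [m] coordinates, one fewer than the powers of [u] considered. *)
pose m := #|{: 'I_D * 'I_r}|.
have /fin_all_exists[a Ha] (i : 'I_m.+1) := Hg (u ^+ i).
(* One exponent [K] of the leading coefficient serves all the pseudo-divisions by [F]. *)
pose K := (\max_i \max_j scalp (a i j) F)%N.
pose rem i j := l ^+ (K - scalp (a i j) F) *: (a i j %% F).
have remE i j : f l ^+ K * (map_poly f (a i j)).[z] = (map_poly f (rem i j)).[z].
  have sK : (scalp (a i j) F <= K)%N.
    apply: leq_trans (leq_bigmax i).
    exact: (leq_bigmax (F := fun j => scalp (a i j) F)).
  have := congr1 (fun P => (map_poly f (l ^+ (K - scalp (a i j) F) *: P)).[z])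
    (Pdiv.Idomain.divp_eq (a i j) F).
  rewrite scalerA -exprD subnK // map_polyZ hornerZ rmorphXn /= => ->.
  rewrite scalerDr rmorphD hornerD scalerAl /= rmorphM hornerM F0.
  by rewrite mulr0 add0r.
have rem_size i j : (size (rem i j) <= D)%N.
  by rewrite (leq_trans (size_scale_leq _ _)) // ltnW // ltn_modp.
(* The column at [ord_max] is zero padding: it makes the matrix square and singular, so a nonzero
   [v] in its left kernel exists over [R]. *)
pose B : 'M[R]_(m.+1) := \matrix_(i, c)
  if unlift ord_max c is Some t then
    let ej := @enum_val _ {: 'I_D * 'I_r} t in (rem i ej.2)`_(ej.1) else 0.
have [v nzv vB] : exists2 v : 'rV[R]_m.+1, v != 0 & v *m B = 0.
  apply/det0P; rewrite (expand_det_col _ ord_max) big1 // => i _.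
  by rewrite mxE unlift_none mul0r.
have vrem e j : \sum_i v 0 i * (rem i j)`_e = 0.
  have [eD|De] := ltnP e D; last first.
    by rewrite big1 // => i _; rewrite nth_default ?mulr0 // (leq_trans _ De).
  have := congr1 (fun M : 'rV_m.+1 => M 0 (lift ord_max (enum_rank (Ordinal eD, j)))) vB.
  rewrite mxE [RHS]mxE => H; rewrite -[RHS]H; apply: eq_bigr => i _.
  by rewrite mxE liftK enum_rankK.
(* The vector [v] gives a relation for [u], whose coefficients cannot all vanish since [l] is
   nonzero in a domain. *)
have /eqP : \poly_(i < m.+1) (l ^+ K * v 0 (inord i)) = 0.
  apply: u_tr; rewrite poly_def rmorph_sum horner_sum.
  transitivity (\sum_j (map_poly f (\sum_i v 0 i *: rem i j)).[z] * g j).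
    under [RHS]eq_bigr => j _ do rewrite rmorph_sum horner_sum mulr_suml.
    rewrite exchange_big /=; apply: eq_bigr => i _.
    rewrite inord_val map_polyZ map_polyXn hornerZ hornerXn rmorphM rmorphXn Ha.
    rewrite mulr_sumr; apply: eq_bigr => j _.
    by rewrite map_polyZ hornerZ -remE !mulrA (mulrC (f (v 0 i))).
  rewrite big1 // => j _; rewrite (_ : \sum_i _ = 0) ?raddf0 ?horner0 ?mul0r //.
  apply/polyP => e; rewrite coef_sum coef0 -[RHS](vrem e j).
  by apply: eq_bigr => i _; rewrite coefZ.
case/rV0Pn: nzv => i nzvi /eqP/polyP/(_ i); rewrite coef_poly ltn_ord inord_val coef0.
by move/eqP; rewrite mulf_eq0 expf_eq0 (negPf nzl) andbF (negPf nzvi).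
Qed.

(** * Linear forms modulo the ideal generated by the first variables *)

Section LinearForms.
Variables (k : fieldType) (S : comAlgType k) (Sg : nat -> {pred S}).
Hypotheses (gr : is_grading Sg) (gr1 : 1 \in Sg 0).
Variables (n : nat) (x : 'I_n -> S).
Hypothesis x1 : forall i, x i \in Sg 1.

Definition in_ideal (y : S) := exists s : 'I_n -> S, y = \sum_i x i * s i.

Lemma in_ideal0 : in_ideal 0.
Proof. by exists (fun _ => 0); rewrite big1 // => i _; rewrite mulr0. Qed.

Lemma in_idealMD a y z : in_ideal y -> in_ideal z -> in_ideal (a * y + z).
Proof.
move=> [s ->] [t ->]; exists (fun i => a * s i + t i).
rewrite mulr_sumr -big_split; apply: eq_bigr => i _.
by rewrite mulrDr mulrCA.
Qed.

Lemma in_idealM a y : in_ideal y -> in_ideal (a * y).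
Proof. by move=> yI; rewrite -[_ * _]addr0; apply: in_idealMD => //; apply: in_ideal0. Qed.

Lemma in_idealD y z : in_ideal y -> in_ideal z -> in_ideal (y + z).
Proof. by rewrite -{2}[y]mul1r; apply: in_idealMD. Qed.

Lemma in_idealBC y z : in_ideal (y - z) -> in_ideal (z - y).
Proof. by rewrite -[z - y]opprB -[- (y - z)]mulN1r; apply: in_idealM. Qed.

Lemma in_ideal_trans y2 y1 y3 :
  in_ideal (y1 - y2) -> in_ideal (y2 - y3) -> in_ideal (y1 - y3).
Proof. by move=> I12 /(in_idealD I12); rewrite addrA subrK. Qed.

Lemma in_ideal_sum (I : finType) (F : I -> S) :
  (forall i, in_ideal (F i)) -> in_ideal (\sum_i F i).
Proof. by move=> FI; apply: big_ind => //; [apply: in_ideal0 | apply: in_idealD]. Qed.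

Definition eventually_generating_mod (z : S) := exists N, forall m y,
  (N <= m)%N -> y \in Sg m.+1 -> exists2 s, s \in Sg m & in_ideal (y - z * s).

Lemma eventually_generating_lastP (x' : 'I_n.+1 -> S) :
  (forall i, x' (widen_ord (leqnSn n) i) = x i) -> x' ord_max \in Sg 1 ->
  eventually_generating Sg x' <-> eventually_generating_mod (x' ord_max).
Proof.
move=> Ex z1; split=> -[N HN]; exists N => m y Nm ym.
  have [s [sm ->]] := HN m y Nm ym; exists (s ord_max) => //.
  rewrite big_ord_recr /= addrK; exists (fun i => s (widen_ord (leqnSn n) i)).
  by apply: eq_bigr => i _; rewrite Ex.
have [pi [pi_in piDZ pi_id piM _]] := grading_projection gr.
have [s sm [t Et]] := HN m y Nm ym.
exists (fun i => if unlift ord_max i is Some j then pi m (t j) else s).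
split=> [i|]; first by case: unliftP.
rewrite big_ord_recr /= unlift_none.
(* The coefficients witnessing ideal membership are arbitrary; projecting to degree [m.+1] replaces
   them by their components of degree [m]. *)
have piE v : pi m.+1 (\sum_i x i * v i) = \sum_i x i * pi m (v i).
  have pi0 : pi m.+1 0 = 0 by apply: pi_id; exact: (grading_rpred0 gr).
  have piD y1 y2 : pi m.+1 (y1 + y2) = pi m.+1 y1 + pi m.+1 y2.
    by rewrite -[y1 in LHS]scale1r piDZ scale1r.
  rewrite (big_morph _ piD pi0); apply: eq_bigr => i _.
  by rewrite (piM 1%N) // subn1.
have yzs : y - x' ord_max * s \in Sg m.+1.
  rewrite addrC -scaleN1r; apply: (grading_rpredDZ gr) => //.
  by rewrite -add1n; apply: (grading_rpredM gr).
apply/eqP; rewrite -subr_eq -(pi_id _ _ yzs) Et piE; apply/eqP/eq_bigr => i _.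
rewrite Ex (_ : widen_ord _ i = lift ord_max i) ?liftK //.
by apply: val_inj; rewrite /= /bump leqNgt ltn_ord.
Qed.

(** * The stable piece of the quotient and the operators on it *)

Section Action.
Variable u : S.
Hypothesis u1 : u \in Sg 1.

Lemma exprn_homog m : u ^+ m \in Sg m.
Proof.
elim: m => [|m IH]; first by rewrite expr0.
by rewrite exprS -add1n; apply: (grading_rpredM gr).
Qed.

Definition comb e (w : 'I_e -> S) (a : 'rV[k]_e) := \sum_i a 0 i *: w i.

Lemma combDZ e (w : 'I_e -> S) c a b : comb w (c *: a + b) = c *: comb w a + comb w b.
Proof.
rewrite /comb scaler_sumr -big_split; apply: eq_bigr => i _.
by rewrite !mxE scalerDl scalerA.
Qed.

Lemma comb0 e (w : 'I_e -> S) : comb w 0 = 0.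
Proof. by rewrite /comb big1 // => i _; rewrite mxE scale0r. Qed.

Lemma combB e (w : 'I_e -> S) a b : comb w (a - b) = comb w a - comb w b.
Proof. by rewrite addrC -scaleN1r combDZ scaleN1r addrC. Qed.

Lemma comb_sum e (w : 'I_e -> S) (I : finType) (c : I -> k) (a : I -> 'rV[k]_e) :
  comb w (\sum_i c i *: a i) = \sum_i c i *: comb w (a i).
Proof.
elim/big_rec2: _ => [|i b y _ <-]; first exact: comb0.
by rewrite combDZ.
Qed.

Lemma comb_delta e (w : 'I_e -> S) i : comb w (delta_mx 0 i) = w i.
Proof.
rewrite /comb (bigD1 i) //= mxE !eqxx scale1r big1 ?addr0 // => j ji.
by rewrite mxE eqxx (negPf ji) scale0r.
Qed.

Lemma comb_homog e (w : 'I_e -> S) N a : (forall i, w i \in Sg N) -> comb w a \in Sg N.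
Proof.
move=> wN; apply: (grading_rpred_sum gr) => i.
exact: (grading_rpredZ gr _ (wN i)).
Qed.

(** With [free_mod], this makes the [u ^+ t * w i] a basis of degree [N + t] modulo the ideal for
    every [t]: [w] is a basis of the stable piece. *)
Definition spans_mod N e (w : 'I_e -> S) := (forall i, w i \in Sg N) /\
  forall t y, y \in Sg (N + t)%N -> exists a, in_ideal (y - u ^+ t * comb w a).

Definition free_mod e (w : 'I_e -> S) :=
  forall t a, in_ideal (u ^+ t * comb w a) -> a = 0.

(* A spanning family of least cardinal is free: from a relation among the
   u^t w_i one of them is redundant in degree N + t and beyond. *)
Lemma spans_mod_free N e (w : 'I_e -> S) : spans_mod N w ->
  exists N' e' (w' : 'I_e' -> S), spans_mod N' w' /\ free_mod w'.
Proof.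
elim: e => [|e IH] in N w *; move=> [wN wspan].
  by exists N, 0%N, w; split=> // t a _; rewrite thinmx0.
have [fw|nfw] := classic (free_mod w); first by exists N, e.+1, w.
have [t [a [aI nza]]] : exists t a, in_ideal (u ^+ t * comb w a) /\ a != 0.
  apply: NNPP => nex; apply: nfw => t a aI; apply/eqP; apply: contraT => nza.
  by case: nex; exists t, a.
have /rV0Pn[i0 nzi0] := nza.
apply: (IH (t + N)%N (fun j => u ^+ t * w (lift i0 j))); split=> [j|t' y].
  exact: (grading_rpredM gr (exprn_homog _) (wN _)).
rewrite addnAC addnC => /wspan[b bI].
(* A multiple of the relation [a] cancels the coordinate at [i0], the index dropped from the
   family. *)
pose b' := (- (b 0 i0 / a 0 i0)) *: a + b.
have b'0 : b' 0 i0 = 0 by rewrite !mxE mulNr divfK ?addNr.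
exists (\row_j b' 0 (lift i0 j)).
have <- : u ^+ t * comb w b' =
    comb (fun j => u ^+ t * w (lift i0 j)) (\row_j b' 0 (lift i0 j)).
  rewrite /comb (bigD1_ord i0) //= b'0 scale0r add0r mulr_sumr.
  by apply: eq_bigr => j _; rewrite mxE scalerAr.
rewrite [u ^+ t' * _]mulrA -exprD [(t' + t)%N]addnC combDZ mulrDr opprD addrCA.
apply: in_idealD bI.
by rewrite -scalerAr -scaleNr addnC exprD -mulrA scalerAl; apply: in_idealM.
Qed.

(** From degree [M] on, [u] acts surjectively modulo the ideal, so a spanning family of [Sg M] spans
    all later degrees through powers of [u]. *)
Lemma exists_spans_mod :
  eventually_generating_mod u -> homog_fin_dim Sg ->
  exists N e (w : 'I_e -> S), spans_mod N w /\ free_mod w.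
Proof.
move=> [M HM] /(_ M)[U [w [wM Hw]]].
apply: (@spans_mod_free M #|U| (fun i => w (enum_val i))); split=> // t.
elim: t => [|t IH] y.
  rewrite addn0 => /Hw[a Ey]; exists (\row_i a (enum_val i)).
  rewrite expr0 mul1r (_ : comb _ _ = y) ?subrr; first exact: in_ideal0.
  rewrite Ey (reindex_onto enum_val enum_rank) /= => [|i _]; rewrite ?enum_rankK //.
  by apply: eq_big => [i|i _]; rewrite ?enum_valK ?eqxx // mxE.
rewrite addnS => yS; have [s sS yI] := HM _ y (leq_addr _ _) yS.
have [a sI] := IH s sS; exists a; apply: in_ideal_trans yI _.
by rewrite exprS -mulrA -mulrBr; apply: in_idealM.
Qed.

Section Matrices.
Variables (N e : nat) (w : 'I_e -> S).
Hypotheses (wspan : spans_mod N w) (wfree : free_mod w).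

(* L is the matrix of multiplication by p / u^m on the stable quotient. *)
Definition acts_as m (p : S) (L : 'M[k]_e) :=
  forall a, in_ideal (p * comb w a - u ^+ m * comb w (a *m L)).

Lemma acts_as_exists m p : p \in Sg m -> exists L, acts_as m p L.
Proof.
move=> pm; have /fin_all_exists[l Hl] i : exists a : 'rV[k]_e,
    in_ideal (p * w i - u ^+ m * comb w a).
  by apply: wspan.2; rewrite addnC; exact: (grading_rpredM gr pm (wspan.1 i)).
exists (\matrix_i l i) => a; rewrite mulmx_sum_row comb_sum /comb !mulr_sumr -sumrB.
apply: in_ideal_sum => i; rewrite rowK -!scalerAr -scalerBr -mulr_algl.
exact: in_idealM.
Qed.

Lemma acts_as_uniq m p L L' : acts_as m p L -> acts_as m p L' -> L = L'.
Proof.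
move=> HL HL'; apply/row_matrixP => i; rewrite !rowE; apply/eqP.
rewrite -subr_eq0; apply/eqP/(wfree (t := m)); rewrite combB mulrBr.
exact: in_ideal_trans (in_idealBC (HL _)) (HL' _).
Qed.

(** Matrices act on row vectors from the right, hence the reversed order. *)
Lemma acts_asM m p L m' q L' : acts_as m p L -> acts_as m' q L' ->
  acts_as (m + m') (p * q) (L' *m L).
Proof.
move=> HL HL' a; rewrite mulmxA.
apply: (in_ideal_trans (y2 := u ^+ m' * (p * comb w (a *m L')))).
  by rewrite -mulrA [in X in _ - X]mulrCA -mulrBr; apply/in_idealM/HL'.
by rewrite addnC exprD -[X in _ - X]mulrA -mulrBr; apply/in_idealM/HL.
Qed.

Lemma acts_as_comm m p L m' q L' : acts_as m p L -> acts_as m' q L' ->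
  L *m L' = L' *m L.
Proof.
move=> HL HL'; apply: acts_as_uniq (acts_asM HL' HL) _.
by rewrite addnC mulrC; apply: acts_asM.
Qed.

Lemma acts_as_sum m (I : finType) (c : I -> k) (p : I -> S) L :
  (forall i, acts_as m (p i) (L i)) ->
  acts_as m (\sum_i c i *: p i) (\sum_i c i *: L i).
Proof.
move=> HL a; rewrite mulmx_sumr (eq_bigr (fun i => c i *: (a *m L i))); last first.
  by move=> i _; rewrite scalemxAr.
rewrite comb_sum mulr_suml mulr_sumr -sumrB; apply: in_ideal_sum => i.
by rewrite -scalerAl -scalerAr -scalerBr -mulr_algl; apply/in_idealM/HL.
Qed.

Lemma acts_as_expr m : acts_as m (u ^+ m) 1%:M.
Proof. by move=> a; rewrite mulmx1 subrr; apply: in_ideal0. Qed.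

(** If [L] is invertible, [u ^+ (m - N).+1 * comb w a] is, modulo the ideal, [z] times
    [u ^+ (m - N) * comb w (a *m invmx L)]. Conversely, dividing [u ^+ M.+1 * w i] by [z] gives row
    [i] of an inverse. *)
Lemma eventually_generating_mod_unitP z L : acts_as 1 z L ->
  eventually_generating_mod z <-> L \in unitmx.
Proof.
move=> HL; split=> [[M HM]|uL]; last first.
  exists N => m y Nm ym.
  have [a yI] : exists a, in_ideal (y - u ^+ (m - N).+1 * comb w a).
    by apply: wspan.2; rewrite addnS subnKC.
  exists (u ^+ (m - N) * comb w (a *m invmx L)).
    rewrite -[X in Sg X](subnK Nm).
    exact: (grading_rpredM gr (exprn_homog _) (comb_homog _ wspan.1)).
  apply: in_ideal_trans yI _.
  rewrite exprSr -mulrA (mulrCA z) -mulrBr; apply/in_idealM/in_idealBC.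
  by have := HL (a *m invmx L); rewrite expr1 mulmxKV.
have /fin_all_exists[b Hb] i : exists b : 'rV[k]_e, b *m L = delta_mx 0 i.
  have yM : u ^+ M.+1 * w i \in Sg (M + N).+1.
    by rewrite -addSn; exact: (grading_rpredM gr (exprn_homog _) (wspan.1 i)).
  have [s sMN yI] := HM _ _ (leq_addr _ _) yM.
  have [b sI] : exists b, in_ideal (s - u ^+ M * comb w b).
    by apply: wspan.2; rewrite addnC.
  (* Freeness cancels the factor [u ^+ M.+1]. *)
  exists b; apply/eqP; rewrite -subr_eq0; apply/eqP/(wfree (t := M.+1)).
  rewrite combB comb_delta mulrBr; apply: in_idealBC.
  apply: in_ideal_trans yI (in_ideal_trans (y2 := z * (u ^+ M * comb w b)) _ _).
    by rewrite -mulrBr; apply: in_idealM.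
  rewrite mulrCA exprSr -mulrA -mulrBr; apply: in_idealM.
  by have := HL b; rewrite expr1.
suff /mulmx1_unit[] : (\matrix_i b i) *m L = 1%:M by [].
by apply/row_matrixP => i; rewrite row_mul rowK Hb rowE mulmx1.
Qed.

End Matrices.
End Action.
End LinearForms.

(** * Noether normalizations and the arrangement *)

Section NoetherNormalization.
Variables (k : fieldType) (S : comAlgType k) (Sg : nat -> {pred S}).

Lemma standard_graded1 : standard_graded Sg -> 1 \in Sg 0.
Proof. by move=> [_ /(_ 1)[_ H] _ _]; apply: H; exists 1; rewrite scale1r. Qed.

Lemma gnn_homog d (x : 'I_d -> S) : is_gnn Sg x -> forall i, x i \in Sg 1.
Proof.
move=> [_ _ H _] i; have := H 1%N 'X_i; rewrite dhomogX /= mdeg1 => /(_ isT).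
by rewrite /= /mpeval mmapX mmap1U.
Qed.

Lemma replace_last_widen n (x : 'I_n.+1 -> S) z i :
  replace_last x z (widen_ord (leqnSn n) i) = x (widen_ord (leqnSn n) i).
Proof. by rewrite /replace_last /= ltnS ltn_ord. Qed.

Lemma replace_last_max n (x : 'I_n.+1 -> S) z : replace_last x z ord_max = z.
Proof. by rewrite /replace_last /= ltnn. Qed.

(** Only injectivity has to be drawn from finiteness: [x ord_max] is transcendental over the other
    variables, and the rank count makes [z] so too. *)
Lemma gnn_replace_last n (x : 'I_n.+1 -> S) z :
  standard_graded Sg -> is_gnn Sg x -> z \in Sg 1 ->
  is_gnn Sg (replace_last x z) <-> module_finite (mpeval (replace_last x z)).
Proof.
move=> Sgr gx z1; have x1 := gnn_homog gx; have [dimS injx _ _] := gx.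
split=> [[]//|fin]; split=> //; last first.
  move=> m p; have [gr _ _ _] := Sgr; apply: mpeval_homog => //.
    exact: standard_graded1.
  by move=> i; rewrite /replace_last; case: ifP.
apply/mpeval_injP; rewrite replace_last_max.
have E : replace_last x z \o widen_ord (leqnSn n) = x \o widen_ord (leqnSn n).
  by apply: functional_extensionality => i; rewrite /= replace_last_widen.
rewrite E; have [r [g Hg]] := fin.
apply: (finite_over_transcendental (u := x ord_max) (g := g)).
  exact/mpeval_injP.
move=> y; have [a ->] := Hg y; exists (fun i => muni (a i)).
by apply: eq_bigr => i _; rewrite mpeval_muni replace_last_max E.
Qed.

Lemma module_finite_lastP n (x : 'I_n -> S) (x' : 'I_n.+1 -> S) :
  is_grading Sg -> 1 \in Sg 0 -> (forall i, x' i \in Sg 1) ->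
  homog_fin_dim Sg ->
  (forall i, x' (widen_ord (leqnSn n) i) = x i) ->
  module_finite (mpeval x') <-> eventually_generating_mod Sg x (x' ord_max).
Proof.
move=> gr gr1 x1 fd Ex; have x1' i : x i \in Sg 1 by rewrite -Ex.
rewrite -(eventually_generating_lastP gr x1' Ex (x1 _)); split.
  exact: module_finite_eventually_generating.
exact: eventually_generating_module_finite.
Qed.

End NoetherNormalization.

Theorem theorem2p2 (k : fieldType) (S : comAlgType k) (Sg : nat -> {pred S})
    (d : nat) (X Y : 'I_d -> S) :
  infinite_field k ->
  standard_graded Sg ->
  krull_dim S d ->
  (1 <= d)%N ->
  is_gnn Sg X ->
  is_gnn Sg Y ->
  exists M : seq {vspace 'rV[k]_d},
    proper_arrangement M /\
    forall c : 'rV[k]_d,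
      ~ in_arrangement M c <->
      is_gnn Sg (replace_last X (\sum_(j < d) c 0 j *: Y j)).
Proof.
case: d X Y => [|n] X Y // kinf Sgr _ _ gX gY.
have gr : is_grading Sg by case: Sgr.
have gr1 := standard_graded1 Sgr; have X1 := gnn_homog gX; have Y1 := gnn_homog gY.
have [_ _ _ Xfin] := gX; have [_ _ _ Yfin] := gY.
have fd := module_finite_homog_fin_dim gr gr1 X1 Xfin.
pose x i := X (widen_ord (leqnSn n) i).
have x1 i : x i \in Sg 1 by apply: X1.
pose u := X ord_max; have u1 : u \in Sg 1 by apply: X1.
have ugen : eventually_generating_mod Sg x u.
  exact/(module_finite_lastP gr gr1 X1 fd (x := x)).
have [N [e [w [wspan wfree]]]] := exists_spans_mod gr gr1 u1 ugen fd.
have /fin_all_exists[L HL] j := acts_as_exists gr wspan (Y1 j).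
have [M HM] := module_finite_eventually_generating gr gr1 Y1 Yfin.
(* Finiteness over the [Y j] puts [u ^+ M.+1] in their ideal, with coefficients [s j] of degree
   [M]. *)
have [s [sM uY]] := HM M _ (leqnn M) (exprn_homog gr gr1 u1 M.+1).
have /fin_all_exists[R HR] j := acts_as_exists gr wspan (sM j).
(* Both sides are matrices of [u ^+ M.+1], which acts as the identity after division by the same
   power of [u]. *)
have LR1 : \sum_j L j *m R j = 1%:M.
  apply: (acts_as_uniq wfree (m := M.+1) (p := u ^+ M.+1)); last exact: acts_as_expr.
  rewrite uY (eq_bigr (fun j => 1 *: (s j * Y j))) => [|j _]; last first.
    by rewrite scale1r mulrC.
  rewrite (eq_bigr (fun j => 1 *: (L j *m R j))) => [|j _]; last by rewrite scale1r.
  by apply: acts_as_sum => j; rewrite -addn1; apply: acts_asM.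
have [V [properV HV]] := commuting_sum_nonunit
  (fun i j => acts_as_comm wfree (HL i) (HL j))
  (fun i j => acts_as_comm wfree (HL i) (HR j)) LR1.
have inV c : in_arrangement V c <-> has (fun W : {vspace 'rV[k]_n.+1} => c \in W) V.
  by split=> [[W WV cW]|/hasP[W WV cW]]; [apply/hasP; exists W | exists W].
exists V; split=> [|c].
  have [c Hc] := vspace_union_avoid kinf properV; exists c.
  by move=> [W WV]; apply/negP/Hc.
pose z := \sum_j c 0 j *: Y j.
have z1 : z \in Sg 1.
  by apply: (grading_rpred_sum gr) => j; apply: (grading_rpredZ gr).
have x'1 i : replace_last X z i \in Sg 1 by rewrite /replace_last; case: ifP.
rewrite inV (gnn_replace_last Sgr gX z1).
rewrite (module_finite_lastP gr gr1 x'1 fd (x := x)); last first.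
  by move=> i; rewrite replace_last_widen.
(* The matrix of [z] is the combination of the [L j] with coefficients [c], and [V] detects when it
   is singular. *)
rewrite replace_last_max (eventually_generating_mod_unitP gr gr1 u1 wspan wfree); last first.
  by apply: acts_as_sum => j; apply: HL.
by rewrite -HV; split=> [/negP|uL]; rewrite ?negbK //; apply/negP; rewrite negbK.
Qed.
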